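(* Let $\alpha\in(0,1]$ and $\beta\in(0,\infty)$. If $\beta\ge\frac{8\alpha}{9}$, then the equation $$\alpha r^3+\alpha r^2+(4\beta-\alpha)r-\alpha=0$$ has a unique root in the interval $(0,\frac13]$, denoted by $\widetilde{R_5}$. Set $$R_5=\begin{cases}\frac13, & \beta\in(0,\frac{8\alpha}{9}),\\[1mm] \widetilde{R_5}, & \beta\in[\frac{8\alpha}{9},\infty).\end{cases}$$ Then for every $f\in\mathcal{BA}(\mathbb{D})$ with $f(z)=\sum_{k=0}^\infty a_kz^k$, it holds that $$\alpha\sum_{k=0}^{\infty}|a_k||z|^k+\beta\left(\frac{S_r}{\pi}\right)\le 1\qquad\text{for all } z\in\mathbb{D}\text{ with }|z|=r\le R_5,$$ where $S_r$ is the area of the image of the subdisk $\mathbb{D}_r=\{z\in\mathbb{C}:|z|<r\}$ under the mapping $f$.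
   Context: $\mathbb{D}=\{z\in\mathbb{C}:|z|<1\}$. $\mathcal{BA}(\mathbb{D})$ is the class of analytic functions $f(z)=\sum_{k=0}^\infty a_kz^k$ on $\mathbb{D}$ with $|f(z)|<1$ for all $z\in\mathbb{D}$. The area $S_r$ is understood as $S_r=\iint_{|z|<r}|f'(z)|^2\,dx\,dy$ (area of the image counted with multiplicity). *)

(* Defs.v *)
From HB Require Import structures.
From mathcomp Require Import all_boot all_order all_algebra.
From mathcomp Require Import all_classical all_reals all_analysis.
From mathcomp Require Import complex.
Set Implicit Arguments.
Unset Strict Implicit.
Unset Printing Implicit Defensive.
Import Order.TTheory GRing.Theory Num.Theory.
Import numFieldNormedType.Exports.
Local Open Scope classical_set_scope.
Local Open Scope ring_scope.

(* The regular algebra R[i]^o carries the normed-module structure of the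
   complex numbers over themselves, so that limits and [derivable _ _ 1] /
   [derive1] are the complex ones. *)
Notation Cplx R := (R[i]^o) (only parsing).

(* Real-valued modulus: the norm `|z| of R[i] takes its values in R[i]. *)
Notation cmod := (@ComplexField.Normc.normc _) (only parsing).

Definition BA (R : realType) (f : Cplx R -> Cplx R) : Prop :=
  forall z : Cplx R, cmod z < 1 -> derivable f z 1 /\ cmod (f z) < 1.

Definition power_series_on_disk (R : realType) (f : Cplx R -> Cplx R)
    (a : nat -> Cplx R) : Prop :=
  forall z : Cplx R, cmod z < 1 ->
    series (fun k => a k * z ^+ k : Cplx R) @ \oo --> f z.

Definition majorant (R : realType) (a : nat -> Cplx R) (r : R) : \bar R :=
  (\sum_(0 <= k <oo) (cmod (a k) * r ^+ k)%:E)%E.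

(* Area of the image of the disk of radius r, counted with multiplicity. *)
Definition area (R : realType) (f : Cplx R -> Cplx R) (r : R) : \bar R :=
  (\int[@lebesgue_measure R \x @lebesgue_measure R]_(p in
      [set p : R * R | (cmod (p.1 +i* p.2)%C < r)%R])
    (cmod (derive1 f (p.1 +i* p.2)%C) ^+ 2)%:E)%E.

Definition R5_root (R : realType) (alpha beta r : R) : Prop :=
  0 < r <= 3^-1 /\
  alpha * r ^+ 3 + alpha * r ^+ 2 + (4 * beta - alpha) * r - alpha = 0.

(* [xget] picks a root; the default 0 is only returned when there is none. *)
Definition R5 (R : realType) (alpha beta : R) : R :=
  if beta < 8 * alpha / 9 then 3^-1
  else xget 0 [set r | R5_root alpha beta r].

(* Main.v *)
Require Import Defs.
From mathcomp Require Import all_boot all_order all_algebra.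
From mathcomp Require Import all_classical all_reals all_analysis.
From mathcomp Require Import complex measurable_realfun ring lra.
From mathcomp Require Import cyclic separable cyclotomic.
Import Order.TTheory GRing.Theory Num.Theory UnityRootTheory.
Import numFieldNormedType.Exports ComplexField.Normc.
Set Implicit Arguments.
Unset Strict Implicit.
Unset Printing Implicit Defensive.
Local Open Scope ring_scope.

(** Let x = |a_0|. Two classical estimates reduce the theorem to an elementary
inequality in x and r:
- |a_k| <= 1 - x^2 for all k >= 1 ([coef_bound]), so that the sum of the
  |a_k| r^k is at most x + (1 - x^2) r / (1 - r) ([majorant_le]);
- consequently S_r / pi, which is the sum of the k |a_k|^2 r^(2k), is at most
  (1 - x^2)^2 r^2 / (1 - r^2)^2 ([area_le]).
The equation that defines R5 reads 4 beta r = alpha (1 - r) (1 + r)^2, and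
r <= R5 implies that r <= 1/3 and that the left-hand side is at most the
right-hand side ([le_R5]). Then beta r^2 / (1 - r^2)^2 is at most
alpha r / (4 (1 - r)), and what is left is an inequality between polynomials
in x, with equality at x = 1 and r = 1/3 ([bohr_area_inequality]).

The coefficient bound rests on Parseval's identity alone. Multiplication by f
does not increase the L2 norm on a circle; tested on 1 + y z^k with a suitable
y, this gives the bound. The circle averages are replaced by averages over
roots of unity ([parseval_prim_root]), which are exact for polynomials, and f
is replaced by its partial sums, which converge uniformly on smaller discs.

For the area, only an upper bound is needed, so Fatou's lemma can do the work
of term-by-term differentiation: f' is the limit of the quotients of
f(z) - f((1 - e) z) by e z, whose power series have coefficients dominated by
those of f'. For a polynomial P, the integral of |P|^2 over a disc is computed
from two facts: the invariance of the Lebesgue measure of the plane under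
rotations ([ge0_integral_rotation]), each rotation being a product of shears,
which allows one to average |P|^2 over roots of unity; and the value of the
integral of |z|^(2k) over a disc ([integral_disc_moment]), which follows from
the divergence theorem, one axis at a time. *)

(** * Moduli and averages over roots of unity *)

Lemma cmodE (R : realType) (z : R[i]) : (cmod z)%:C%C = `|z|.
Proof. by rewrite normc_def; case: z. Qed.

Lemma prim_root_exists (F : numClosedFieldType) n :
  (0 < n)%N -> exists z : F, n.-primitive_root z.
Proof.
move=> n_gt0; pose p : {poly F} := 'X^n - 1.
have [r Dp] := closed_field_poly_normal p.
rewrite (monicP _) ?monicXnsubC // scale1r in Dp.
have rn1 : all n.-unity_root r by apply/allP => z; rewrite -root_prod_XsubC -Dp.
have sz_r : (n < (size r).+1)%N.
  by rewrite -(size_prod_XsubC r id) -Dp size_XnsubC.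
have [|z] := hasP (has_prim_root n_gt0 rn1 _ sz_r); last by exists z.
by rewrite -separable_prod_XsubC -Dp separable_Xn_sub_1 // pnatr_eq0 -lt0n.
Qed.

Lemma norm_prim_root (F : numClosedFieldType) n (w : F) :
  n.-primitive_root w -> `|w| = 1.
Proof.
move=> pw; have n0 := prim_order_gt0 pw.
by apply/eqP; rewrite -(pexpr_eq1 n0)// -normrX prim_expr_order// normr1.
Qed.

(** The characters m |-> w ^ m of the group of n-th roots of unity are
orthogonal: off the diagonal, the sum is a geometric one whose ratio is an
n-th root of unity other than 1. *)
Lemma sum_prim_root_conj (F : numClosedFieldType) n (w : F) (m l : 'I_n) :
  n.-primitive_root w ->
  \sum_(j < n) (w ^+ j) ^+ m * ((w ^+ j) ^+ l)^* = (n * (m == l))%:R.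
Proof.
move=> pw; have n0 := prim_order_gt0 pw; have w1 := norm_prim_root pw.
have wU : w^* * w = 1 by rewrite mulrC -normCK w1 expr1n.
pose u := w ^+ m * (w ^+ l)^*.
have -> : \sum_(j < n) (w ^+ j) ^+ m * ((w ^+ j) ^+ l)^* = \sum_(j < n) u ^+ j.
  apply: eq_bigr => j _.
  by rewrite /u exprMn -!exprM !rmorphXn/= -!exprM ![(_ * j)%N]mulnC.
have [ml|ml] := eqVneq m l.
  rewrite /u ml -normCK normrX w1 !expr1n muln1.
  by under eq_bigr do rewrite expr1n; rewrite sumr_const card_ord.
have ul : u * w ^+ l = w ^+ m.
  by rewrite /u -mulrA rmorphXn/= -exprMn wU expr1n mulr1.
have u1 : u - 1 != 0.
  rewrite subr_eq0; apply: contra ml => /eqP u1.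
  move: ul; rewrite u1 mul1r => /eqP; rewrite (eq_prim_root_expr pw).
  by rewrite /eqn !modn_small// => /eqP e; apply/eqP/val_inj.
have wn k : (w ^+ k) ^+ n = 1.
  by rewrite -exprM mulnC exprM (prim_expr_order pw) expr1n.
apply: (mulfI u1); rewrite muln0 mulr0 -subrX1 /u exprMn -rmorphXn/= !wn.
by rewrite rmorph1 mulr1 subrr.
Qed.

(** Parseval's identity. Averaging over n equidistributed points of a circle,
instead of integrating over it, is exact for polynomials of degree less than
n, and so avoids contour integrals. *)
Lemma parseval_prim_root (R : realType) n (w : R[i]) (c : nat -> R[i])
    (z : R[i]) :
  n.-primitive_root w ->
  \sum_(j < n) cmod (\sum_(m < n) c m * (w ^+ j * z) ^+ m) ^+ 2 =
  n%:R * \sum_(m < n) cmod (c m) ^+ 2 * cmod z ^+ (2 * m).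
Proof.
move=> pw; apply: complexI.
rewrite rmorphM rmorph_nat !rmorph_sum/=.
transitivity (\sum_(j < n) \sum_(m < n) \sum_(l < n)
    (c m * z ^+ m * (c l * z ^+ l)^*) * ((w ^+ j) ^+ m * ((w ^+ j) ^+ l)^*)).
  apply: eq_bigr => j _; rewrite rmorphXn/= cmodE normCK.
  rewrite rmorph_sum/= big_distrl/=.
  apply: eq_bigr => m _; rewrite big_distrr/=; apply: eq_bigr => l _.
  by rewrite !exprMn !rmorphM/=; ring.
rewrite exchange_big/= mulr_sumr; apply: eq_bigr => m _.
rewrite exchange_big/= (bigD1 m)//= [X in _ + X]big1 ?addr0; last first.
  move=> l lm; rewrite -mulr_sumr sum_prim_root_conj//.
  by rewrite eq_sym (negbTE lm) muln0 mulr0.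
rewrite -mulr_sumr sum_prim_root_conj// eqxx muln1 -normCK mulrC.
by rewrite rmorphM !rmorphXn/= !cmodE normrM exprMn normrX -!exprM mulnC.
Qed.

Section modulus.
Variable R : realType.
Implicit Types z w : R[i].

Lemma cmod_ge0 z : 0 <= cmod z.
Proof. by case: z => x y; exact: sqrtr_ge0. Qed.

Lemma cmodX z n : cmod (z ^+ n) = cmod z ^+ n.
Proof. by apply: complexI; rewrite rmorphXn/= !cmodE normrX. Qed.

Lemma cmod_sum (I : Type) (s : seq I) (P : pred I) (F : I -> R[i]) :
  cmod (\sum_(i <- s | P i) F i) <= \sum_(i <- s | P i) cmod (F i).
Proof.
elim/big_rec2 : _ => [|i y x _ le_xy]; first by rewrite normc0.
by rewrite (le_trans (le_normcD _ _))// lerD2l.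
Qed.

Lemma cmod_real (x : R) : cmod (x%:C)%C = `|x|.
Proof. by rewrite /= expr0n addr0 sqrtr_sqr. Qed.

Lemma cmodJ z : cmod (z^*)%C = cmod z.
Proof. by case: z => x y /=; rewrite sqrrN. Qed.

Lemma cmod_direction z : exists2 u, cmod u = 1 & z = (cmod z)%:C%C * u.
Proof.
have [z0|z0] := eqVneq z 0.
  by exists 1; [exact: normc1|rewrite z0 normc0 mul0r].
have c0 : (cmod z)%:C%C != 0 :> R[i] by rewrite cmodE normr_eq0.
exists (z / (cmod z)%:C%C); last by rewrite mulrC divfK.
apply: complexI.
rewrite normcM normcV cmod_real ger0_norm ?cmod_ge0// divff//.
by rewrite -(inj_eq (@complexI R)).
Qed.

End modulus.

(** * Coefficients of a power series bounded by one *)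

(** Multiplication by a function bounded by K has norm at most K in the L2 norm
of the circle. For the bound on the coefficient of index k it is enough to
test it on 1 + y z ^ k and to keep the coefficients of indices 0 and k of the
product, which are c 0 and c k + y c 0. The choice of y with |y| = |c 0|
making c k and y c 0 point in the same direction gives the claim. With K = 1
it is equivalent to |c k| <= 1 - |c 0| ^ 2, a bound usually derived from the
Schwarz-Pick lemma. *)
Lemma poly_coef_contraction (R : realType) (c : nat -> R[i]) N k (K : R) :
  (0 < k < N)%N ->
  (forall z : R[i], cmod z = 1 -> cmod (\sum_(m < N) c m * z ^+ m) <= K) ->
  cmod (c 0) ^+ 2 + (cmod (c k) + cmod (c 0) ^+ 2) ^+ 2 <=
    K ^+ 2 * (1 + cmod (c 0) ^+ 2).
Proof.
move=> /andP[k0 kN] PK.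
have [u u1 cku] := cmod_direction (c k).
pose y : R[i] := (c 0)^*%C * u.
have yc0 : cmod y = cmod (c 0) by rewrite normcM cmodJ u1 mulr1.
pose p : {poly R[i]} := \poly_(m < N) c m.
pose t : {poly R[i]} := 1 + y *: 'X^k.
(* The product p * t has degree less than N + k, so that N + k points are
   enough for Parseval's identity. *)
pose n := (N + k)%N.
have n0 : (0 < n)%N by rewrite addn_gt0 (leq_trans _ kN).
have [w pw] := @prim_root_exists R[i] _ n0.
have w1 j : cmod (w ^+ j * 1) = 1.
  by apply: complexI; rewrite cmodE mulr1 normrX (norm_prim_root pw) expr1n.
have parseval (q : {poly R[i]}) : (size q <= n)%N ->
    \sum_(j < n) cmod q.[w ^+ j * 1] ^+ 2 = n%:R * \sum_(m < n) cmod q`_m ^+ 2.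
  move=> sq; have := parseval_prim_root (fun m => q`_m) 1 pw.
  under [in RHS]eq_bigr do rewrite normc1 expr1n mulr1.
  by move=> <-; apply: eq_bigr => j _; rewrite -horner_coef_wide.
have st : (size t <= k.+1)%N.
  rewrite (leq_trans (size_polyD _ _))// geq_max size_poly1 ltnS leq0n/=.
  by rewrite (leq_trans (size_scale_leq _ _))// size_polyXn.
have sq : (size (p * t)%R <= n)%N.
  rewrite (leq_trans (size_polyMleq _ _))//.
  have : (size p + size t <= N + k.+1)%N by rewrite leq_add// size_poly.
  by case: (size p + size t)%N => // m; rewrite addnS ltnS.
have pt : p * t = p + y *: (p * 'X^k) by rewrite mulrDr mulr1 scalerAr.
have kn : (k < n)%N by rewrite ltn_addr.
have two_terms (q : {poly R[i]}) :
    cmod q`_0 ^+ 2 + cmod q`_k ^+ 2 <= \sum_(m < n) cmod q`_m ^+ 2.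
  rewrite (bigD1 (Ordinal n0))//= lerD2l (bigD1 (Ordinal kn))/=; last first.
    by rewrite -val_eqE/= -lt0n.
  by rewrite lerDl sumr_ge0// => i _; exact: sqr_ge0.
have t_norm : \sum_(m < n) cmod t`_m ^+ 2 = 1 + cmod (c 0) ^+ 2.
  have tE m : t`_m = (m == 0)%:R + y * (m == k)%:R.
    by rewrite coefD coef1 coefZ coefXn.
  rewrite (bigD1 (Ordinal n0))//= (bigD1 (Ordinal kn))/=; last first.
    by rewrite -val_eqE/= -lt0n.
  rewrite big1 ?addr0 => [|i /andP[i0 ik]]; last first.
    move: i0 ik; rewrite -!val_eqE/= tE => /negbTE -> /negbTE ->.
    by rewrite mulr0 addr0 normc0 expr0n.
  rewrite !tE !eqxx (gtn_eqF k0) (ltn_eqF k0) mulr0 mulr1 addr0 add0r.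
  by rewrite normc1 expr1n yc0.
have := two_terms (p * t).
have -> : (p * t)`_0 = c 0.
  by rewrite pt coefD coefZ coefMXn k0 mulr0 addr0 coef_poly (ltn_trans k0).
have -> : (p * t)`_k = (cmod (c k) + cmod (c 0) ^+ 2)%:C%C * u.
  rewrite pt coefD coefZ coefMXn ltnn subnn !coef_poly kN (ltn_trans k0)//.
  rewrite rmorphD rmorphXn/= mulrDl -cku cmodE sqr_normc /y; congr (_ + _).
  by rewrite mulrAC [_^*%C * _]mulrC.
rewrite normcM u1 mulr1 cmod_real => /le_trans.
rewrite real_normK ?num_real//; apply.
rewrite -(@ler_pM2l _ n%:R) ?ltr0n// -parseval// mulrCA -t_norm.
rewrite -parseval; last first.
  by rewrite (leq_trans st)// ltn_addr.
rewrite mulr_sumr; apply: ler_sum => j _.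
rewrite hornerM normcM exprMn ler_wpM2r ?sqr_ge0//.
rewrite ler_sqr ?nnegrE ?cmod_ge0//; first by rewrite horner_poly PK.
by rewrite (le_trans (cmod_ge0 _) (PK 1 (normc1 _))).
Qed.

Local Open Scope classical_set_scope.

(** The norm of R[i] takes its values in R[i]: this brings convergence back to
real bounds on the modulus. *)
Lemma cvg_cmodP (R : realType) (u : nat -> Cplx R) (l : Cplx R) :
  u @ \oo --> l <->
  forall e : R, 0 < e -> \forall n \near \oo, cmod (l - u n) <= e.
Proof.
split=> [/cvgrPdist_le ul e e0|ul].
  have := ul e%:C%C; rewrite ltcR => /(_ e0).
  by apply: filterS => n; rewrite -[`|_|]cmodE lecR.
apply/cvgrPdist_le => -[e e'] /=; rewrite ltcE/= => /andP[/eqP -> e0].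
have := ul _ e0; apply: filterS => n ule.
by rewrite -[`|_|]cmodE lecR.
Qed.

Lemma geometric_tail_le (R : realType) (q : R) N M : 0 <= q < 1 ->
  \sum_(N <= k < M) q ^+ k <= q ^+ N / (1 - q).
Proof.
move=> /andP[q0 q1].
rewrite ler_pdivlMr ?subr_gt0//.
have [NM|MN] := leqP N M; last by rewrite big_geq ?mul0r ?exprn_ge0// ltnW.
suff -> : (\sum_(N <= k < M) q ^+ k) * (1 - q) = q ^+ N - q ^+ M.
  by rewrite lerBlDr lerDl exprn_ge0.
elim: M NM => [|M IH NM].
  by rewrite leqn0 => /eqP ->; rewrite big_geq// mul0r subrr.
move: NM; rewrite leq_eqVlt => /predU1P[->|NM].
  by rewrite big_geq// mul0r subrr.
by rewrite big_nat_recr//= mulrDl IH// exprSr; ring.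
Qed.

Section coefficients.
Variables (R : realType) (f : Cplx R -> Cplx R) (a : nat -> Cplx R).
Hypothesis fa : power_series_on_disk f a.

Lemma coef_geometric_bound (s : R) : 0 <= s < 1 ->
  \forall k \near \oo, cmod (a k) * s ^+ k <= 1.
Proof.
move=> /andP[s0 s1].
have sn : cmod (s%:C%C) < 1 by rewrite cmod_real ger0_norm.
have /cvg_cmodP/(_ (2^-1)) := fa sn.
rewrite invr_gt0 ltr0n => /(_ isT) [N _ SN]; exists N => // k /= Nk.
have := le_normcD (f s%:C%C - series (fun k => a k * s%:C%C ^+ k : Cplx R) k)
  (- (f s%:C%C - series (fun k => a k * s%:C%C ^+ k : Cplx R) k.+1)).
rewrite normcN opprB [X in cmod X]addrC addrA subrK seriesSB.
rewrite normcM cmodX cmod_real ger0_norm//.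
move=> /le_trans; apply; rewrite [1]splitr div1r lerD// SN//=.
exact: leqW.
Qed.

(** Between rho and 1 there is s, for which the terms a k * s ^ k are bounded
by 1 from some rank on: the tails are dominated by those of the geometric
series of ratio rho / s, uniformly on the closed disc of radius rho. *)
Lemma power_series_unif_cvg (rho e : R) : 0 <= rho < 1 -> 0 < e ->
  \forall N \near \oo, forall z : Cplx R, cmod z <= rho ->
    cmod (f z - \sum_(k < N) a k * z ^+ k) <= e.
Proof.
move=> /andP[r0 r1] e0.
pose s := (1 + rho) / 2.
have s0 : 0 < s by rewrite /s; lra.
have s1 : s < 1 by rewrite /s; lra.
pose q := rho / s.
have q0 : 0 <= q by rewrite divr_ge0// ltW.
have q1 : q < 1 by rewrite ltr_pdivrMr// mul1r /s; lra.
have [N1 _ aN1] : \forall k \near \oo, cmod (a k) * s ^+ k <= 1.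
  by apply: coef_geometric_bound; rewrite (ltW s0).
have [N2 _ qN2] : \forall N \near \oo, q ^+ N <= (1 - q) * (e / 2).
  have /cvgrPdist_le : q ^+ n @[n --> \oo] --> (0 : R).
    by apply: cvg_expr; rewrite ger0_norm.
  move=> /(_ ((1 - q) * (e / 2))); rewrite mulr_gt0 ?subr_gt0 ?divr_gt0//.
  move=> /(_ isT); apply: filterS => n.
  by rewrite sub0r normrN ger0_norm// exprn_ge0.
exists (maxn N1 N2) => // N /=; rewrite geq_max => /andP[N1N N2N] z zr.
have z1 : cmod z < 1 by rewrite (le_lt_trans zr).
have /cvg_cmodP/(_ (e / 2)) := fa z1.
rewrite divr_gt0// => /(_ isT) [M _ /(_ (maxn M N))/=].
rewrite leq_maxl => /(_ isT); set L := maxn M N => fL.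
have NL : (N <= L)%N by rewrite leq_maxr.
rewrite -(subrK (series (fun k => a k * z ^+ k : Cplx R) L) (f z)) -addrA.
rewrite (le_trans (le_normcD _ _))// [leRHS]splitr lerD//.
rewrite /series/= -(big_mkord xpredT (fun k => a k * z ^+ k)).
rewrite (big_cat_nat (leq0n N) NL)//=.
rewrite addrAC subrr add0r (le_trans (cmod_sum _ _ _))//.
have : \sum_(N <= k < L) q ^+ k <= e / 2.
  rewrite (le_trans (geometric_tail_le _ _ _)) ?q0//.
  by rewrite ler_pdivrMr ?subr_gt0// mulrC qN2.
apply: le_trans; rewrite big_nat [leRHS]big_nat.
apply: ler_sum => k /andP[Nk kL].
rewrite normcM cmodX (@le_trans _ _ (cmod (a k) * rho ^+ k))//.
  by rewrite ler_wpM2l ?cmod_ge0// lerXn2r ?nnegrE ?cmod_ge0.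
rewrite -[rho](divfK (lt0r_neq0 s0)) -/q exprMn mulrCA ler_piMr ?exprn_ge0//.
by rewrite aN1//= (leq_trans N1N).
Qed.

Lemma power_series_at0 : f 0 = a 0.
Proof.
have c0 : cmod (0 : R[i]) < 1 by rewrite normc0.
apply: (cvg_unique _ (fa c0)) => //.
apply/cvgrPdist_le => e e0; exists 1%N => // -[//|n] _.
rewrite /series/= big_nat_recl// expr0 mulr1 big1 ?addr0 ?subrr ?normr0 ?ltW//.
by move=> i _; rewrite expr0n mulr0.
Qed.

Hypothesis fBA : BA f.

Lemma coef0_lt1 : cmod (a 0) < 1.
Proof.
have c0 : cmod (0 : R[i]) < 1 by rewrite normc0.
by have [_] := fBA c0; rewrite power_series_at0.
Qed.

(** On the circle of radius rho the partial sums of the series are bounded by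
1 + h for any h > 0, so [poly_coef_contraction] applies to them, and h then
goes to 0. *)
Lemma coef_scaled_bound k (rho : R) : (0 < k)%N -> 0 < rho < 1 ->
  cmod (a k) * rho ^+ k + cmod (a 0) ^+ 2 <= 1.
Proof.
move=> k0 /andP[r0 r1].
set A := cmod (a 0).
have A0 : 0 <= A by exact: cmod_ge0.
have A1 : A < 1 by exact: coef0_lt1.
suff H : A ^+ 2 + (cmod (a k) * rho ^+ k + A ^+ 2) ^+ 2 <= 1 + A ^+ 2.
  have {}H : (cmod (a k) * rho ^+ k + A ^+ 2) ^+ 2 <= 1 by lra.
  rewrite -(@ler_pXn2r _ 2)// ?nnegrE ?expr1n// addr_ge0 ?sqr_ge0//.
  by rewrite mulr_ge0 ?exprn_ge0 ?cmod_ge0// ltW.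
apply/ler_addgt0Pr => e e0.
(* Since h <= 1 and |a 0| <= 1, the error (1 + h) ^ 2 - 1 <= 3 h is
   multiplied by at most 2. *)
pose h := Num.min 1 (e / 6).
have h0 : 0 < h by rewrite lt_min ltr01 divr_gt0.
have [N1 _ fN1] : \forall N \near \oo, forall z : Cplx R, cmod z <= rho ->
    cmod (f z - \sum_(k < N) a k * z ^+ k) <= h.
  by apply: power_series_unif_cvg; rewrite ?(ltW r0).
pose N := maxn N1 k.+1.
pose c m := a m * rho%:C%C ^+ m.
have cE m : cmod (c m) = cmod (a m) * rho ^+ m.
  by rewrite normcM cmodX cmod_real gtr0_norm.
have := @poly_coef_contraction R c N k (1 + h).
rewrite k0 leq_maxr !cE expr0 mulr1 -/A => /(_ isT) H.
have {}H : A ^+ 2 + (cmod (a k) * rho ^+ k + A ^+ 2) ^+ 2 <=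
    (1 + h) ^+ 2 * (1 + A ^+ 2).
  apply: H => z z1.
  have rz : cmod (rho%:C%C * z) = rho.
    by rewrite normcM z1 cmod_real mulr1 gtr0_norm.
  have fz := fN1 N (leq_maxl _ _) (rho%:C%C * z); rewrite rz lexx in fz.
  have -> : \sum_(m < N) c m * z ^+ m = f (rho%:C%C * z) -
      (f (rho%:C%C * z) - \sum_(k < N) a k * (rho%:C%C * z) ^+ k).
    rewrite opprB addrC subrK; apply: eq_bigr => m _.
    by rewrite exprMn mulrA.
  rewrite (le_trans (le_normcD _ _))// normcN lerD ?fz//.
  have rz1 : cmod (rho%:C%C * z) < 1 by rewrite rz.
  by have [_ /ltW] := fBA rz1.
have h1 : h <= 1 by rewrite ge_min lexx.
have h2 : h <= e / 6 by rewrite ge_min lexx orbT.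
have h3 : (1 + h) ^+ 2 <= 1 + 3 * h by nra.
have A2 : 0 <= A ^+ 2 <= 1 by rewrite sqr_ge0 expr_le1// ltW.
rewrite (le_trans H)// (le_trans (ler_wpM2r _ h3)); nra.
Qed.

(** The limit rho --> 1 of the previous bound, made explicit with Bernoulli's
inequality. *)
Lemma coef_bound k : (0 < k)%N -> cmod (a k) <= 1 - cmod (a 0) ^+ 2.
Proof.
move=> k0; set C := cmod (a k).
have C0 : 0 <= C by exact: cmod_ge0.
apply/ler_addgt0Pr => e e0.
pose D := C * k%:R + 1.
have D0 : 0 < D by rewrite ltr_wpDl// mulr_ge0.
pose d := Num.min 2^-1 (e / D).
have d0 : 0 < d by rewrite lt_min invr_gt0 ltr0n divr_gt0.
have d1 : d <= 2^-1 by rewrite ge_min lexx.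
have d2 : d * D <= e by rewrite -ler_pdivlMr// ge_min lexx orbT.
have bernoulli n : 1 - n%:R * d <= (1 - d) ^+ n.
  elim: n => [|n IH]; first by rewrite mul0r subr0 expr0.
  rewrite exprS -[n.+1]add1n natrD.
  have n0 : 0 <= n%:R :> R by [].
  have := ler_wpM2l (_ : 0 <= 1 - d) IH; rewrite subr_ge0 => /(_ ltac:(lra)).
  nra.
have /(_ (1 - d)) := @coef_scaled_bound k _ k0; rewrite -/C.
have -> : 0 < 1 - d < 1 by apply/andP; split; lra.
move=> /(_ isT).
have := ler_wpM2l C0 (bernoulli k); rewrite /D in d2.
nra.
Qed.

End coefficients.

(** * Rotation invariance of the Lebesgue measure of the plane *)

Section plane_measure.
Variable R : realType.
Local Notation mu := (@lebesgue_measure R).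
Local Notation mu2 := (@lebesgue_measure R \x @lebesgue_measure R)%E.
Local Open Scope ereal_scope.

Let shift (c : R) : R -> measurableTypeR R := fun x => (x + c)%R.

Let measurable_shift c : measurable_fun setT (shift c).
Proof. exact: measurable_funD. Qed.

(** Both sides are measures in A, so it is enough to compare them on half-open
intervals. *)
Lemma lebesgue_measure_shift (c : R) (A : set R) : measurable A ->
  pushforward mu (shift c) A = mu A.
Proof.
move=> mA.
apply/esym; have := @lebesgue_measure_unique R (pushforward mu (shift c)).
apply=> [|m _ [[a b]] _ <-|//]; first exact: measurable_shift.
rewrite -[RHS]/(mu (shift c @^-1` `]a, b]%classic)) /=.
have -> : shift c @^-1` `]a, b]%classic = `](a - c)%R, (b - c)%R]%classic.
  by apply/seteqP; split => x /=; rewrite /shift !in_itv/= ltrBlDr lerBrDr.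
rewrite !lebesgue_measure_itv/= !lte_fin ltrD2r.
by case: ifP => // _; rewrite -!EFinD; congr EFin; ring.
Qed.

Lemma ge0_integral_shift (c : R) (F : R -> \bar R) :
  measurable_fun setT F -> (forall x, 0 <= F x) ->
  \int[mu]_x F (x + c)%R = \int[mu]_x F x.
Proof.
move=> mF F0; transitivity (\int[pushforward mu (shift c)]_x F x).
  by rewrite ge0_integral_pushforward//; exact: measurable_shift.
apply: eq_measure_integral => [|m A mA _]; first exact: measurable_shift.
exact: lebesgue_measure_shift.
Qed.

Lemma measurable_shear1 (t : R) :
  measurable_fun setT (fun p : R * R => (p.1 + t * p.2, p.2)%R).
Proof.
apply: measurable_fun_pair => //.
by apply: measurable_funD => //; exact: measurable_funM.
Qed.

Lemma measurable_shear2 (t : R) :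
  measurable_fun setT (fun p : R * R => (p.1, p.2 + t * p.1)%R).
Proof.
apply: measurable_fun_pair => //.
by apply: measurable_funD => //; exact: measurable_funM.
Qed.

(** By Tonelli's theorem a shear acts on each horizontal line as a translation,
which preserves the integral along that line. *)
Lemma ge0_integral_shear1 (t : R) (F : R * R -> \bar R) :
  measurable_fun setT F -> (forall x, 0 <= F x) ->
  \int[mu2]_p F (p.1 + t * p.2, p.2)%R = \int[mu2]_p F p.
Proof.
move=> mF F0.
rewrite fubini_tonelli2//; last first.
  exact: measurableT_comp mF (measurable_shear1 t).
rewrite fubini_tonelli2//; apply: eq_integral => y _.
rewrite /fubini_G/= (@ge0_integral_shift _ (fun x => F (x, y)))//.
exact: measurableT_comp.
Qed.

Lemma ge0_integral_shear2 (t : R) (F : R * R -> \bar R) :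
  measurable_fun setT F -> (forall x, 0 <= F x) ->
  \int[mu2]_p F (p.1, p.2 + t * p.1)%R = \int[mu2]_p F p.
Proof.
move=> mF F0.
rewrite fubini_tonelli1//; last first.
  exact: measurableT_comp mF (measurable_shear2 t).
rewrite fubini_tonelli1//; apply: eq_integral => x _.
rewrite /fubini_F/= (@ge0_integral_shift _ (fun y => F (x, y)))//.
exact: measurableT_comp.
Qed.

(** The points of the plane are pairs for the product measure and complex
numbers for the analysis: [cplx] and [pair_of] pass from one to the other. *)
Definition cplx (p : R * R) : R[i] := (p.1 +i* p.2)%C.

Definition pair_of (z : R[i]) : R * R := (complex.Re z, complex.Im z).

(** A rotation other than the half-turn is a product of three shears, so that
Tonelli's theorem takes the place of a change of variables in the plane. *)
Lemma ge0_integral_rotation_neqN1 (w : R[i]) (F : R * R -> \bar R) :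
  cmod w = 1%R -> complex.Re w != (-1)%R ->
  measurable_fun setT F -> (forall x, 0 <= F x) ->
  \int[mu2]_p F (pair_of (w * cplx p)%R) = \int[mu2]_p F p.
Proof.
case: w => c s /= w1 c1 mF F0.
have {w1} cs : (c ^+ 2 + s ^+ 2 = 1)%R.
  by rewrite -[LHS]sqr_sqrtr ?addr_ge0 ?sqr_ge0// w1 expr1n.
pose t := (s / (1 + c))%R.
have c10 : (1 + c != 0)%R by rewrite addrC addr_eq0.
(* With tan (theta / 2) = t, the rotation by theta is the product of three
   shears of parameters - t, s and - t. *)
pose F1 p := F (p.1 + - t * p.2, p.2)%R.
pose F2 p := F1 (p.1, p.2 + s * p.1)%R.
have F10 p : 0 <= F1 p by exact: F0.
have F20 p : 0 <= F2 p by exact: F0.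
have mF1 : measurable_fun setT F1.
  exact: measurableT_comp mF (measurable_shear1 _).
have mF2 : measurable_fun setT F2.
  exact: measurableT_comp mF1 (measurable_shear2 _).
rewrite -(@ge0_integral_shear1 (- t) F)// -(@ge0_integral_shear2 s F1)//.
rewrite -(@ge0_integral_shear1 (- t) F2)//.
have ts : (1 - t * s = c)%R.
  apply: (mulIf c10); rewrite /t mulrBl mul1r mulrAC divfK// -expr2.
  by rewrite -{1}cs; ring.
have tc : (t * (1 + c) = s)%R by rewrite /t divfK.
apply: eq_integral => -[x y] _; rewrite /F2 /F1/=.
rewrite -[pair_of _]/((c * x - s * y)%R, (c * y + s * x)%R).
congr (F (_, _)); last by rewrite -ts; ring.
have e1 : (c * x = (1 - t * s) * x)%R by rewrite ts.
have e2 : (s * y = t * (1 + c) * y)%R by rewrite tc.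
have e3 : (c * (t * y) = (1 - t * s) * (t * y))%R by rewrite ts.
by clearbody t; lra.
Qed.

Lemma measurable_rotation (w : R[i]) :
  measurable_fun setT (fun p : R * R => pair_of (w * cplx p)%R).
Proof.
case: w => c s; apply: measurable_fun_pair => /=.
  by apply: measurable_funB; exact: measurable_funM.
by apply: measurable_funD; exact: measurable_funM.
Qed.

Lemma ge0_integral_rotation (w : R[i]) (F : R * R -> \bar R) : cmod w = 1%R ->
  measurable_fun setT F -> (forall x, 0 <= F x) ->
  \int[mu2]_p F (pair_of (w * cplx p)%R) = \int[mu2]_p F p.
Proof.
move=> w1 mF F0.
have [wN1|] := eqVneq (complex.Re w) (-1)%R; last first.
  by move=> ?; exact: ge0_integral_rotation_neqN1.
(* The half-turn is the square of a quarter-turn. *)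
have wE : w = (('i)%C * ('i)%C)%R.
  case: w w1 wN1 => c s /= w1 cN1.
  have : (c ^+ 2 + s ^+ 2 = 1)%R.
    by rewrite -[LHS]sqr_sqrtr ?addr_ge0 ?sqr_ge0// w1 expr1n.
  rewrite cN1 sqrrN expr1n => /eqP.
  rewrite -subr_eq0 addrC addKr sqrf_eq0 => /eqP ->.
  by rewrite -expr2 sqr_i; apply/eqP; rewrite eq_complex/= oppr0 !eqxx.
have i1 : cmod (('i)%C : R[i]) = 1%R.
  by rewrite /= expr0n expr1n add0r sqrtr1.
have iN1 : complex.Re (('i)%C : R[i]) != (-1)%R.
  by rewrite /= eq_sym oppr_eq0 oner_eq0.
rewrite -(ge0_integral_rotation_neqN1 i1 iN1 mF F0).
rewrite -[RHS](ge0_integral_rotation_neqN1 i1 iN1)//; last first.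
  exact: (measurableT_comp mF (@measurable_rotation _)).
apply: eq_integral => -[x y] _; rewrite wE -mulrA.
by congr (F (pair_of (_ * _)%R)).
Qed.
End plane_measure.

(** * Moments of a disc *)

Section disc_moments.
Variable R : realType.
Local Notation mu := (@lebesgue_measure R).
Local Notation mu2 := (@lebesgue_measure R \x @lebesgue_measure R)%E.

Lemma derivable_LRcontinuous (F : R -> R) a b :
  (forall x, derivable F x 1) -> derivable_oo_LRcontinuous F a b.
Proof.
move=> dF.
have cF x : {for x, continuous F}.
  exact/differentiable_continuous/derivable1_diffP.
split=> [x _|//|//]; first exact: dF.
  by apply: cvg_at_right_filter; exact: cF.
by apply: cvg_at_left_filter; exact: cF.
Qed.

(** The area of a disc, through the substitution y = r sin t: the integrand
becomes 2 (r cos t) ^ 2, of primitive r ^ 2 (t + sin t cos t). *)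
Lemma integral_semicircle (r : R) : 0 <= r ->
  (\int[mu]_y (2 * Num.sqrt (r ^+ 2 - y ^+ 2))%:E = (pi * r ^+ 2)%:E)%E.
Proof.
move=> r0.
have csq : continuous (fun y : R => Num.sqrt (r ^+ 2 - y ^+ 2)).
  move=> y; apply: continuous_comp; last exact: sqrt_continuous.
  by apply: cvgB; [exact: cvg_cst|exact: exprn_continuous].
have msq : measurable_fun setT (fun y : R => (Num.sqrt (r ^+ 2 - y ^+ 2))%:E).
  by apply/measurable_EFinP; exact: continuous_measurable_fun.
under eq_integral do rewrite EFinM.
rewrite ge0_integralZl//=.
rewrite [X in (_ * X)%E](_ : _ = \int[mu]_(y in `[(- r)%R, r%R])
    (Num.sqrt (r ^+ 2 - y ^+ 2))%:E)%E; last first.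
  rewrite [RHS]integral_mkcond; apply: eq_integral => y _.
  rewrite patchE; case: ifPn => //; rewrite notin_setE/= in_itv/= => /negP.
  rewrite -ler_norml -ltNge => ry; rewrite ler0_sqrtr// subr_le0.
  by rewrite -[leRHS]real_normK ?num_real// ler_sqr ?nnegrE// ltW.
pose F (t : R) : R := r * sin t.
have rF : r = F (pi / 2) by rewrite /F sin_pihalf mulr1.
have rNF : - r = F (- (pi / 2)) by rewrite /F sinN sin_pihalf mulrN1.
have [r00|r_neq0] := eqVneq r 0.
  rewrite r00 oppr0 set_itv1 integral_set1 expr0n mulr0 mule0//.
have {r_neq0}r0 : 0 < r by rewrite lt0r r_neq0.
have dF (t : R) : is_derive t (1 : R) F (r * cos t).
  by rewrite /F; apply: is_derive_eq.
have F'E : F^`() = (fun t => r * cos t).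
  by apply/funext => t; rewrite derive1E; exact: derive_val.
have cF' : continuous (fun t => r * cos t).
  by move=> t; apply: cvgM; [exact: cvg_cst|exact: continuous_cos].
have cF'2 : continuous (fun t : R => (r * cos t) ^+ 2).
  move=> t; under eq_fun do rewrite expr2.
  by apply: cvgM; exact: cF'.
have pi2 : - (pi / 2) < pi / 2 :> R.
  by rewrite gtrN// divr_gt0// pi_gt0.
rewrite rNF [X in `[_, X]]rF.
rewrite integration_by_substitution_increasing//; last 7 first.
- exact: ltW.
- by move=> s t sI tI st; rewrite /F ltr_pM2l// ltr_sin.
- by rewrite F'E => t _; exact: cF'.
- rewrite F'E; apply/cvg_ex; eexists; apply: cvg_at_right_filter; exact: cF'.
- rewrite F'E; apply/cvg_ex; eexists; apply: cvg_at_left_filter; exact: cF'.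
- by apply: derivable_LRcontinuous => t; exact: ex_derive.
- exact: continuous_subspaceT.
pose H (t : R) : R := r ^+ 2 / 2 * (t + sin t * cos t).
have dH (t : R) : is_derive t (1 : R) H ((r * cos t) ^+ 2).
  rewrite /H; apply: is_derive_eq.
  by rewrite /GRing.scale/= mulrN -expr2 sin2cos2; field.
rewrite [X in (_ * X)%E](_ : _ = \int[mu]_(t in `[(- (pi / 2))%R, (pi / 2)%R])
    ((r * cos t) ^+ 2)%:E)%E; last first.
  apply: eq_integral.
  move=> t; rewrite inE/= in_itv/= => tpi; congr EFin.
  rewrite F'E.
  rewrite -[LHS]/(Num.sqrt (r ^+ 2 - (r * sin t) ^+ 2) * (r * cos t)).
  have -> : r ^+ 2 - (r * sin t) ^+ 2 = (r * cos t) ^+ 2.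
    by rewrite !exprMn cos2sin2; ring.
  by rewrite sqrtr_sqr ger0_norm ?expr2// mulr_ge0 ?cos_ge0_pihalf// ltW.
rewrite (@continuous_FTC2 _ _ H)//.
- rewrite -EFinB -EFinM /H !cosN !cos_pihalf; congr EFin; field.
- by [].
- exact: continuous_subspaceT cF'2.
- by apply: derivable_LRcontinuous => t; exact: ex_derive.
- by move=> t _; rewrite derive1E; exact: derive_val.
Qed.

(** The integrand is the derivative of x * (x ^ 2 + y ^ 2) ^ k with respect to
x, and x ^ 2 + y ^ 2 = r ^ 2 at both ends of the slice. The square root of a
negative number being 0, the formula also covers the lines that miss the
disc. When k = 0 the factor k cancels the term in which k.-1 is truncated. *)
Lemma integral_disc_slice (r y : R) k :
  (\int[mu]_x ((fun x => ((x ^+ 2 + y ^+ 2) ^+ k +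
      2 * k%:R * x ^+ 2 * (x ^+ 2 + y ^+ 2) ^+ k.-1)%:E) \_
      [set x | (x ^+ 2 + y ^+ 2 <= r ^+ 2)%R]) x =
   (r ^+ (2 * k) * (2 * Num.sqrt (r ^+ 2 - y ^+ 2)))%:E)%E.
Proof.
rewrite -integral_mkcond.
set X := Num.sqrt _.
have [ry|ry] := leP (y ^+ 2) (r ^+ 2); last first.
  rewrite (_ : [set x | _] = set0) ?integral_set0; last first.
    apply/seteqP; split => x //=; apply/negP; rewrite -ltNge.
    by rewrite (lt_le_trans ry)// lerDr sqr_ge0.
  by rewrite /X ler0_sqrtr ?mulr0// subr_le0 ltW.
have XE : X ^+ 2 = r ^+ 2 - y ^+ 2 by rewrite sqr_sqrtr// subr_ge0.
have X0 : 0 <= X by exact: sqrtr_ge0.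
have -> : [set x | x ^+ 2 + y ^+ 2 <= r ^+ 2] = `[- X, X]%classic.
  apply/seteqP; split => x /=; rewrite in_itv/= -ler_norml.
    by rewrite -lerBrDr -XE -[_ <= X]ler_sqr ?nnegrE// real_normK ?num_real.
  by rewrite -lerBrDr -XE -[_ <= X]ler_sqr ?nnegrE// real_normK ?num_real.
have [->|XN0] := eqVneq X 0.
  by rewrite oppr0 set_itv1 integral_set1 !mulr0.
pose F (x : R) : R := x * (x ^+ 2 + y ^+ 2) ^+ k.
pose g (x : R) : R :=
  (x ^+ 2 + y ^+ 2) ^+ k + 2 * k%:R * x ^+ 2 * (x ^+ 2 + y ^+ 2) ^+ k.-1.
have dF (x : R) : is_derive x (1 : R) F (g x).
  have -> : F = (id : R -> R) * ((id : R -> R) ^+ 2 + cst (y ^+ 2)) ^+ k.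
    by apply/funext => t; rewrite !fctE.
  apply: is_derive_eq.
  by rewrite !fctE /g /GRing.scale/= expr1; ring.
have cg : continuous g.
  move=> x; apply/differentiable_continuous/derivable1_diffP.
  have -> : g = ((id : R -> R) ^+ 2 + cst (y ^+ 2)) ^+ k +
      cst (2 * k%:R) * (id : R -> R) ^+ 2 *
      ((id : R -> R) ^+ 2 + cst (y ^+ 2)) ^+ k.-1.
    by apply/funext => t; rewrite !fctE.
  exact: ex_derive.
transitivity ((F X)%:E - (F (- X))%:E)%E; last first.
  by rewrite -EFinB /F; congr EFin; rewrite sqrrN XE subrK -exprM; ring.
apply: (@continuous_FTC2 _ g F).
- by rewrite gtrN// lt0r XN0.
- exact: continuous_subspaceT cg.
- by apply: derivable_LRcontinuous => x; exact: ex_derive.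
- by move=> x _; rewrite derive1E; exact: derive_val.
Qed.

Definition normsq (p : R * R) := p.1 ^+ 2 + p.2 ^+ 2.

Definition disc (r : R) := [set p : R * R | normsq p <= r ^+ 2].

Lemma measurable_normsq : measurable_fun setT normsq.
Proof. by apply: measurable_funD; exact: measurable_funX. Qed.

Lemma measurable_disc r : measurable (disc r).
Proof.
rewrite -[disc r]setTI.
have mr : measurable_fun setT (cst (r ^+ 2) : R * R -> R).
  exact: measurable_cst.
by apply: (measurable_fun_ler measurable_normsq mr).
Qed.

(** Instead of polar coordinates, the divergence theorem for the vector field
|p| ^ (2 k) p, of divergence (2 k + 2) |p| ^ (2 k): the derivative along each
axis is integrated slice by slice, and each of the two contributes r ^ (2 k)
times the area of the disc. *)
Lemma integral_disc_moment (r : R) k : 0 <= r ->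
  (\int[mu2]_(p in disc r) (normsq p ^+ k)%:E =
   (pi * r ^+ (2 * k.+1) / k.+1%:R)%:E)%E.
Proof.
move=> r0.
(* The derivative of u * (u ^ 2 + v ^ 2) ^ k with respect to u. *)
pose g (u v : R) : R := (u ^+ 2 + v ^+ 2) ^+ k +
  2 * k%:R * u ^+ 2 * (u ^+ 2 + v ^+ 2) ^+ k.-1.
have g0 u v : 0 <= g u v.
  have n0 : 0 <= u ^+ 2 + v ^+ 2 by rewrite addr_ge0 ?sqr_ge0.
  apply: addr_ge0; first exact: exprn_ge0.
  apply: mulr_ge0; last exact: exprn_ge0.
  by rewrite mulr_ge0 ?sqr_ge0.
have mg : measurable_fun setT (fun p : R * R => (g p.1 p.2)%:E).
  apply/measurable_EFinP; apply: measurable_funD.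
    exact: measurable_funX measurable_normsq.
  apply: measurable_funM; last exact: measurable_funX measurable_normsq.
  by apply: measurable_funM => //; exact: measurable_funX.
have mg' : measurable_fun setT (fun p : R * R => (g p.2 p.1)%:E).
  exact: (measurableT_comp mg (@measurable_swap _ _ _ _)).
have half : (\int[mu]_y (r ^+ (2 * k) * (2 * Num.sqrt (r ^+ 2 - y ^+ 2)))%:E =
    (pi * r ^+ (2 * k.+1))%:E)%E.
  under eq_integral do rewrite EFinM.
  rewrite ge0_integralZl//=.
  - rewrite integral_semicircle// -EFinM mulnS exprD; congr EFin; ring.
  - apply/measurable_EFinP; apply: continuous_measurable_fun => y.
    apply: cvgM; first exact: cvg_cst.
    apply: continuous_comp; last exact: sqrt_continuous.
    by apply: cvgB; [exact: cvg_cst|exact: exprn_continuous].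
  - by rewrite lee_fin exprn_ge0.
have G1 : (\int[mu2]_(p in disc r) (g p.1 p.2)%:E =
    (pi * r ^+ (2 * k.+1))%:E)%E.
  rewrite integral_mkcond fubini_tonelli2//; last 2 first.
  - apply: (measurable_restrictT _ (measurable_disc r)).1.
    exact: measurable_funTS.
  - by move=> p; apply: erestrict_ge0 => q _; rewrite lee_fin.
  rewrite -half; apply: eq_integral => y _.
  by rewrite /fubini_G -integral_disc_slice.
have G2 : (\int[mu2]_(p in disc r) (g p.2 p.1)%:E =
    (pi * r ^+ (2 * k.+1))%:E)%E.
  rewrite integral_mkcond fubini_tonelli1//; last 2 first.
  - apply: (measurable_restrictT _ (measurable_disc r)).1.
    exact: measurable_funTS.
  - by move=> p; apply: erestrict_ge0 => q _; rewrite lee_fin.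
  rewrite -half; apply: eq_integral => x _.
  rewrite /fubini_F -integral_disc_slice; apply: eq_integral => y _.
  rewrite !patchE; congr (if _ then _ else _).
  by apply/idP/idP; rewrite !inE /disc /normsq/= addrC.
have G12 : (\int[mu2]_(p in disc r) ((2 * k.+1%:R)%:E * (normsq p ^+ k)%:E) =
    (2 * (pi * r ^+ (2 * k.+1)))%:E)%E.
  rewrite [in RHS]mulr_natl mulr2n EFinD -{1}G1 -G2.
  rewrite -ge0_integralD//; last 5 first.
  - exact: measurable_disc.
  - by move=> p _; rewrite lee_fin.
  - exact: measurable_funTS.
  - by move=> p _; rewrite lee_fin.
  - exact: measurable_funTS.
  apply: eq_integral => p _; rewrite -EFinM -EFinD /g; congr EFin.
  rewrite [p.2 ^+ 2 + _]addrC -/(normsq p).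
  case: k {G1 G2 half mg mg' g0 g} => [|k]; first by rewrite !expr0; ring.
  by rewrite exprS /normsq -[in RHS]natr1; ring.
move: G12; rewrite ge0_integralZl//; last 3 first.
- exact: measurable_disc.
- apply/measurable_EFinP; apply: measurable_funX.
  exact: measurable_funTS measurable_normsq.
- by move=> p _; rewrite lee_fin exprn_ge0// addr_ge0 ?sqr_ge0.
have k0 : (2 * k.+1%:R)%R != 0 :> R by rewrite mulf_neq0// pnatr_eq0.
move=> /(congr1 (fun x => (2 * k.+1%:R)^-1%:E * x)%E).
rewrite muleA -EFinM mulVf// mul1e -EFinM => ->; congr EFin.
by field.
Qed.
End disc_moments.

(** * Area of the image of a disc *)

Section area_bound.
Variable R : realType.
Local Notation mu := (@lebesgue_measure R).
Local Notation mu2 := (@lebesgue_measure R \x @lebesgue_measure R)%E.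

Lemma cmod_sqr (z : R[i]) : cmod z ^+ 2 = normsq (pair_of z).
Proof.
by case: z => x y; rewrite /normsq/= sqr_sqrtr// addr_ge0 ?sqr_ge0.
Qed.

Lemma pair_ofK : cancel (@pair_of R) (@cplx R).
Proof. by case. Qed.

(** Measurability into the plane is that of the real and imaginary parts, and
those of a polynomial are built from real sums and products. *)
Lemma measurable_cplx_poly (c : nat -> R[i]) n :
  measurable_fun setT (fun p => pair_of (\sum_(m < n) c m * cplx p ^+ m)).
Proof.
pose meas (g : R * R -> R[i]) :=
  measurable_fun setT (fun p => complex.Re (g p)) /\
  measurable_fun setT (fun p => complex.Im (g p)).
have measD g h : meas g -> meas h -> meas (fun p => g p + h p).
  move=> [g1 g2] [h1 h2]; split.
    have -> : (fun p => complex.Re (g p + h p)) =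
       (fun p => complex.Re (g p)) \+ (fun p => complex.Re (h p)).
      by apply/funext => p /=; case: (g p) (h p) => ? ? [].
    exact: measurable_funD.
  have -> : (fun p => complex.Im (g p + h p)) =
     (fun p => complex.Im (g p)) \+ (fun p => complex.Im (h p)).
    by apply/funext => p /=; case: (g p) (h p) => ? ? [].
  exact: measurable_funD.
have measM g h : meas g -> meas h -> meas (fun p => g p * h p).
  move=> [g1 g2] [h1 h2]; split.
    have -> : (fun p => complex.Re (g p * h p)) =
       ((fun p => complex.Re (g p)) \* (fun p => complex.Re (h p))) \-
       ((fun p => complex.Im (g p)) \* (fun p => complex.Im (h p))).
      by apply/funext => p /=; case: (g p) (h p) => ? ? [].
    by apply: measurable_funB; exact: measurable_funM.
  have -> : (fun p => complex.Im (g p * h p)) =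
     ((fun p => complex.Re (g p)) \* (fun p => complex.Im (h p))) \+
     ((fun p => complex.Im (g p)) \* (fun p => complex.Re (h p))).
    by apply/funext => p /=; case: (g p) (h p) => ? ? [].
  by apply: measurable_funD; exact: measurable_funM.
have meas_cst (w : R[i]) : meas (cst w) by split; exact: measurable_cst.
have meas_cplx : meas (@cplx R).
  by split; [exact: measurable_fst|exact: measurable_snd].
have measX m : meas (fun p => cplx p ^+ m).
  elim: m => [|m IH]; first exact: meas_cst.
  by under eq_fun do rewrite exprS; exact: measM.
suff [h1 h2] : meas (fun p => \sum_(m < n) c m * cplx p ^+ m).
  exact: measurable_fun_pair.
elim: n => [|n IH].
  by under eq_fun do rewrite big_ord0; exact: meas_cst.
under eq_fun do rewrite big_ord_recr/=.
by apply: measD => //; apply: measM => //; exact: meas_cst.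
Qed.

Lemma measurable_cplx_poly_sq (c : nat -> R[i]) n :
  measurable_fun setT (fun p => cmod (\sum_(m < n) c m * cplx p ^+ m) ^+ 2).
Proof.
under eq_fun do rewrite cmod_sqr.
exact: (measurableT_comp (@measurable_normsq R) (measurable_cplx_poly c n)).
Qed.

(** The monomials are orthogonal on the disc. By rotation invariance |P| ^ 2 may
be replaced by its average over the rotations by n-th roots of unity, which
by Parseval's identity is the sum of the |c m| ^ 2 |p| ^ (2 m). *)
Lemma integral_disc_poly_sq (c : nat -> R[i]) n (r : R) : 0 <= r ->
  (\int[mu2]_(p in disc r) (cmod (\sum_(m < n) c m * cplx p ^+ m) ^+ 2)%:E =
   (\sum_(m < n) cmod (c m) ^+ 2 * (pi * r ^+ (2 * m.+1) / m.+1%:R))%:E)%E.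
Proof.
move=> r0.
case: n => [|n].
  rewrite big_ord0 integral0_eq// => p _.
  by rewrite big_ord0 normc0 expr0n.
have [w pw] := @prim_root_exists R[i] n.+1 isT.
have w1 j : cmod (w ^+ j) = 1.
  by apply: complexI; rewrite cmodE normrX (norm_prim_root pw) expr1n.
pose F p := (cmod (\sum_(m < n.+1) c m * cplx p ^+ m) ^+ 2)%:E.
have F0 p : (0 <= F p)%E by rewrite lee_fin sqr_ge0.
have mF : measurable_fun setT F.
  by apply/measurable_EFinP; exact: measurable_cplx_poly_sq.
have mD := @measurable_disc R r.
have mFD : measurable_fun setT (F \_ (disc r)).
  by apply: (measurable_restrictT _ mD).1; exact: measurable_funTS.
have FD0 p : (0 <= (F \_ (disc r)) p)%E by apply: erestrict_ge0.
have mean : (n.+1%:R%:E * \int[mu2]_(p in disc r) F p =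
    \int[mu2]_(p in disc r)
      (n.+1%:R * \sum_(m < n.+1) cmod (c m) ^+ 2 * normsq p ^+ m)%:E)%E.
  transitivity (\sum_(j < n.+1)
      \int[mu2]_p (F \_ (disc r)) (pair_of (w ^+ j * cplx p)%R))%E.
    under eq_bigr do rewrite ge0_integral_rotation//.
    rewrite -integral_mkcond sumr_const card_ord.
    by rewrite mule_natl.
  rewrite -(@ge0_integral_sum _ _ _ mu2 setT measurableT _
    (fun (j : 'I_n.+1) p =>
      (F \_ (disc r)) (pair_of (w ^+ j * cplx p)%R))); last 2 first.
  - by move=> j; exact: (measurableT_comp mFD (@measurable_rotation R _)).
  - by move=> j p _; exact: FD0.
  rewrite [RHS]integral_mkcond; apply: eq_integral => p _.
  have np : cmod (cplx p) ^+ 2 = normsq p by rewrite cmod_sqr; case: p.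
  have pD j : (pair_of (w ^+ j * cplx p) \in disc r) = (p \in disc r).
    by apply/idP/idP; rewrite !inE /disc/= -cmod_sqr normcM w1 mul1r np.
  rewrite patchE; case: ifPn => [pin|pout]; last first.
    by apply: big1 => j _; rewrite patchE pD (negbTE pout).
  under eq_bigr do rewrite patchE pD pin.
  rewrite sumEFin; congr EFin.
  have := parseval_prim_root c (cplx p) pw.
  under [in RHS]eq_bigr do rewrite exprM np.
  by move=> <-; apply: eq_bigr => j _; rewrite pair_ofK.
have mN m : measurable_fun (disc r) (fun p => (normsq p ^+ m)%:E).
  apply/measurable_EFinP; apply: measurable_funX.
  exact: measurable_funTS (@measurable_normsq R).
have n0 p : 0 <= normsq p :> R by rewrite addr_ge0 ?sqr_ge0.
have term m : (\int[mu2]_(p in disc r) (cmod (c m) ^+ 2 * normsq p ^+ m)%:E =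
    (cmod (c m) ^+ 2 * (pi * r ^+ (2 * m.+1) / m.+1%:R))%:E)%E.
  under eq_integral do rewrite EFinM.
  rewrite ge0_integralZl//; first by rewrite integral_disc_moment.
  - exact: mN.
  - by move=> p _; rewrite lee_fin exprn_ge0.
  - by rewrite lee_fin sqr_ge0.
have total : (\int[mu2]_(p in disc r)
    (n.+1%:R * \sum_(m < n.+1) cmod (c m) ^+ 2 * normsq p ^+ m)%:E =
    n.+1%:R%:E * (\sum_(m < n.+1) cmod (c m) ^+ 2 *
      (pi * r ^+ (2 * m.+1) / m.+1%:R))%:E)%E.
  under eq_integral do rewrite EFinM -sumEFin.
  have mS m : measurable_fun (disc r)
      (fun p => (cmod (c m) ^+ 2 * normsq p ^+ m)%:E).
    by under eq_fun do rewrite EFinM; exact: measurable_funeM.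
  have S0 m p : (0 <= (cmod (c m) ^+ 2 * normsq p ^+ m)%:E)%E.
    by rewrite lee_fin mulr_ge0 ?sqr_ge0 ?exprn_ge0.
  rewrite ge0_integralZl; last 4 first.
  - exact: mD.
  - by apply: emeasurable_sum => m; exact: mS.
  - by move=> p _; apply: sume_ge0 => m _; exact: S0.
  - by rewrite lee_fin.
  rewrite (@ge0_integral_sum _ _ _ mu2 _ mD _
    (fun (m : 'I_n.+1) p => (cmod (c m) ^+ 2 * normsq p ^+ m)%:E));
    last 2 first.
  - by move=> m; exact: mS.
  - by move=> m p _; exact: S0.
  by under eq_bigr do rewrite term; rewrite sumEFin.
move: mean; rewrite total => /(congr1 (fun x => (n.+1%:R)^-1%:E * x)%E).
by rewrite !muleA -EFinM mulVf ?pnatr_eq0// !mul1e.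
Qed.

(** The form of Fatou's lemma used below: a uniform bound on the integrals
passes to the pointwise limit. *)
Lemma fatou_bound d (T : measurableType d) (nu : {measure set T -> \bar R})
    (D : set T) (f : nat -> T -> R) (g : T -> R) (C : \bar R) : measurable D ->
  (forall n, measurable_fun D (f n)) -> (forall n x, D x -> 0 <= f n x) ->
  (forall x, D x -> f n x @[n --> \oo] --> g x) ->
  (forall n, (\int[nu]_(x in D) (f n x)%:E <= C)%E) ->
  (\int[nu]_(x in D) (g x)%:E <= C)%E.
Proof.
move=> mD mf f0 fg fC.
have := @fatou _ _ _ nu D mD (fun n x => (f n x)%:E).
have -> : (\int[nu]_(x in D) limn_einf (fun n => (f n x)%:E) =
    \int[nu]_(x in D) (g x)%:E)%E.
  apply: eq_integral => x; rewrite inE => Dx.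
  have gx : (f n x)%:E @[n --> \oo] --> (g x)%:E.
    by apply: cvg_EFin; [exact: nearW|exact: fg].
  by have [->] := cvg_limn_einf_sup gx.
move=> /(_ _ _)/le_trans; apply.
- by move=> n; exact/measurable_EFinP.
- by move=> n x Dx; rewrite lee_fin f0.
rewrite limn_einf_lim; apply: lime_le; first exact: is_cvg_einfs.
apply: nearW => n.
apply: (@le_trans _ _ (\int[nu]_(x in D) (f n x)%:E)%E) => //.
by apply: ereal_inf_lbound; exists n => /=.
Qed.

Lemma cvg_cmod (u : nat -> Cplx R) (l : Cplx R) :
  u @ \oo --> l -> cmod (u n) @[n --> \oo] --> cmod l.
Proof.
move=> /cvg_cmodP ul; apply/cvgrPdist_le => e e0.
have := ul _ e0; apply: filterS => n; apply: le_trans.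
have := le_normcD (l - u n) (u n); rewrite subrK.
have := le_normcD (u n - l) l; rewrite subrK -[cmod (u n - l)]normcN opprB.
by rewrite ler_norml; lra.
Qed.

Lemma cvg_cmod_sqr (u : nat -> Cplx R) (l : Cplx R) :
  u @ \oo --> l -> cmod (u n) ^+ 2 @[n --> \oo] --> cmod l ^+ 2.
Proof.
move=> /cvg_cmod ul; rewrite expr2; under eq_fun do rewrite expr2.
exact: cvgM.
Qed.

Lemma derive1_quotient_seq (f : Cplx R -> Cplx R) (z : Cplx R)
    (h : nat -> Cplx R) :
  derivable f z 1 -> h @ \oo --> (0 : Cplx R) -> (forall n, h n != 0) ->
  ((h n)^-1 * (f (h n + z) - f z) : Cplx R) @[n --> \oo] --> derive1 f z.
Proof.
move=> df h0 hn0.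
have -> : (fun n => (h n)^-1 * (f (h n + z) - f z)) =
  (fun k : Cplx R => k^-1 *: (f (k *: 1 + z) - f z)) \o h.
  by apply/funext => n /=; rewrite /GRing.scale/= mulr1.
rewrite derive1E.
apply: (@cvg_comp _ _ _ h _ _ (0 : Cplx R)^'); last exact: df.
move=> A; rewrite /dnbhs/= /within/= => nA.
have := h0 _ nA; rewrite /nbhs/=; apply: filterS => n /=; apply.
exact: hn0.
Qed.

(** The partial sums of the Koebe function s / (1 - s) ^ 2. *)
Lemma sum_natmul_geom_le (s : R) n : 0 <= s < 1 ->
  \sum_(k < n) k.+1%:R * s ^+ k.+1 <= s / (1 - s) ^+ 2.
Proof.
move=> /andP[s0 s1]; have s10 : 0 < 1 - s by rewrite subr_gt0.
rewrite ler_pdivlMr ?exprn_gt0//.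
have -> : (\sum_(k < n) k.+1%:R * s ^+ k.+1) * (1 - s) ^+ 2 =
    s * (1 - s ^+ n * (1 + n%:R * (1 - s))).
  elim: n => [|n IH]; first by rewrite big_ord0 expr0; ring.
  by rewrite big_ord_recr/= mulrDl IH !exprSr -natr1; ring.
rewrite ler_piMr// lerBlDr lerDl mulr_ge0 ?exprn_ge0//.
by rewrite addr_ge0// mulr_ge0// ltW.
Qed.

(** (1 - (1 - e) ^ k) / e is the sum of the (1 - e) ^ j for j < k. That it is at
most k means that passing to the quotient of f along a contraction loses
nothing against the term-by-term derivative. *)
Lemma one_sub_pow_bound (e : R) k : 0 < e <= 1 ->
  0 <= (1 - (1 - e) ^+ k) / e <= k%:R.
Proof.
move=> /andP[e0 e1].
have q0 : 0 <= 1 - e by rewrite subr_ge0.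
have q1 : 1 - e <= 1 by rewrite gerBl ltW.
rewrite divr_ge0 ?(ltW e0) ?subr_ge0 ?exprn_ile1//= ler_pdivrMr//.
elim: k => [|k IH]; first by rewrite expr0 subrr mul0r.
have qk : 0 <= (1 - e) ^+ k <= 1 by rewrite exprn_ge0// exprn_ile1.
rewrite exprSr -natr1; nra.
Qed.

Section bounded_coefficients.
Variables (f : Cplx R -> Cplx R) (a : nat -> Cplx R) (B : R).
Hypothesis fa : power_series_on_disk f a.
Hypothesis fd : forall z, cmod z < 1 -> derivable f z 1.
Hypothesis aB : forall k, (0 < k)%N -> cmod (a k) <= B.

Let eps m : R := m.+2%:R^-1.

Let eps01 m : 0 < eps m < 1.
Proof. by rewrite invr_gt0 ltr0n/= invf_lt1// ltr1n. Qed.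

Let eps_small (c e : R) : 0 < e -> \forall n \near \oo, eps n * c <= e.
Proof.
move=> e0; exists (Num.bound (`|c| / e)) => // n /= bn.
have ce : `|c| / e < n%:R.
  rewrite (lt_le_trans (archi_boundP _)) ?ler_nat//.
  by rewrite divr_ge0// ltW.
rewrite mulrC ler_pdivrMr ?ltr0n// (le_trans (ler_norm _))//.
rewrite ltr_pdivrMr// in ce; rewrite (le_trans (ltW ce))// mulrC.
by rewrite ler_pM2l// ler_nat -addn2 leq_addr.
Qed.

Let eps_neq0 m : (eps m)%:C%C != 0 :> R[i].
Proof. by apply/eqP => -[] e0; have := eps01 m; rewrite e0 ltxx. Qed.

Let eps_cvg0 (w : R[i]) :
  (- (eps n)%:C%C * w : Cplx R) @[n --> \oo] --> (0 : Cplx R).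
Proof.
apply/cvg_cmodP => e e0; have := eps_small (cmod w) e0; apply: filterS => n.
have [en _] := andP (eps01 n).
by rewrite sub0r normcN normcM normcN cmod_real gtr0_norm.
Qed.

(** [dilation_quotient m] is the difference quotient of f between z and its
contraction (1 - eps m) z. It is a power series whose coefficients have
modulus at most B * k.+1, as those of f' do, and it tends to f': the area is
bounded through it instead of through the derived series. At the origin,
where the contraction does not move z, it takes the value of its power
series. *)
Let dilation_coef m k : R[i] :=
  a k.+1 * ((1 - (1 - eps m) ^+ k.+1) / eps m)%:C%C.

Let dilation_quotient m (z : R[i]) : R[i] := if z == 0 then a 1%N else
  (- (eps m)%:C%C * z)^-1 * (f (- (eps m)%:C%C * z + z) - f z).

Lemma dilation_quotient_series m z : cmod z < 1 ->
  (\sum_(k < n) dilation_coef m k * z ^+ k : Cplx R) @[n --> \oo] -->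
  (dilation_quotient m z : Cplx R).
Proof.
move=> z1; rewrite /dilation_quotient.
have [e0 e1] := andP (eps01 m).
case: eqP => [->|/eqP z0].
  apply/cvg_cmodP => e ee0; exists 1%N => // -[//|n] _.
  rewrite big_ord_recl expr0 mulr1 big1 ?addr0; last first.
    by move=> k _; rewrite expr0n mulr0.
  rewrite /dilation_coef expr1 opprB addrCA subrr addr0 divff ?lt0r_neq0//.
  by rewrite rmorph1 mulr1 subrr normc0 ltW.
set w := - _ * z + z.
have wE : w = (1 - eps m)%:C%C * z.
  by rewrite /w rmorphB rmorph1 mulrBl mul1r mulNr addrC.
have w1 : cmod w < 1.
  rewrite wE normcM cmod_real gtr0_norm ?subr_gt0//.
  by rewrite (le_lt_trans _ z1)// ler_piMl ?cmod_ge0// gerBl ltW.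
have Sw : series (fun k => a k * w ^+ k : Cplx R) n.+1 @[n --> \oo] --> f w.
  by have := fa w1; rewrite -cvg_shiftS.
have Sz : series (fun k => a k * z ^+ k : Cplx R) n.+1 @[n --> \oo] --> f z.
  by have := fa z1; rewrite -cvg_shiftS.
have H := @cvgZl_tmp _ _ _ _ _ ((- (eps m)%:C%C * z)^-1) _ _ (cvgB Sw Sz).
suff -> : (fun n => \sum_(k < n) dilation_coef m k * z ^+ k) =
    (fun n => (- (eps m)%:C%C * z)^-1 *
      (\sum_(0 <= k < n.+1) a k * w ^+ k - \sum_(0 <= k < n.+1) a k * z ^+ k)).
  exact: H.
apply/funext => n; rewrite -sumrB big_nat_recl// !expr0 subrr add0r.
rewrite big_mkord mulr_sumr.
apply: eq_bigr => k _.
rewrite /dilation_coef wE exprMn -rmorphXn/= rmorphM fmorphV rmorphB rmorph1/=.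
rewrite [z ^+ k.+1]exprS; have := eps_neq0 m.
set e := (eps m)%:C%C; set q := (X in 1 - X).
rewrite -[X in X * (z * _)]/q.
by move: e q => e q ne0; field; rewrite z0 ne0.
Qed.

Lemma power_series_remainder2 z : cmod z < 1 ->
  cmod (f z - a 0%N - a 1%N * z) <= B * (cmod z ^+ 2 / (1 - cmod z)).
Proof.
move=> z1.
have B0 : 0 <= B := le_trans (cmod_ge0 _) (@aB 1%N isT).
apply/ler_addgt0Pr => e e0.
have /cvg_cmodP/(_ _ e0) [N _ /(_ (maxn N 2))/=] := fa z1.
rewrite leq_maxl => /(_ isT); set M := maxn N 2.
rewrite /series/= (big_cat_nat (leq0n 2) (leq_maxr N 2))/=.
rewrite big_nat_recr//= big_nat1.
rewrite expr0 mulr1 expr1 => fM.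
set T := \sum_(2 <= i < M) a i * z ^+ i in fM.
have -> : f z - a 0%N - a 1%N * z = T + (f z - (a 0%N + a 1%N * z + T)) by ring.
rewrite (le_trans (le_normcD _ _))// lerD//.
rewrite (le_trans (cmod_sum _ _ _))//.
apply: (@le_trans _ _ (\sum_(2 <= i < M) B * cmod z ^+ i)).
  rewrite big_nat [leRHS]big_nat; apply: ler_sum => k /andP[k2 _].
  rewrite normcM cmodX ler_wpM2r ?exprn_ge0 ?cmod_ge0// aB//.
  exact: ltn_trans k2.
rewrite -mulr_sumr ler_wpM2l//; apply: geometric_tail_le.
by rewrite cmod_ge0.
Qed.

(** The origin is fixed by the contractions, which carry no information on the
derivative there: it is read off the quadratic bound on the remainder. *)
Lemma derive1_at0 : derive1 f 0 = a 1%N.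
Proof.
have d0 : derivable f 0 1 by apply: fd; rewrite normc0.
pose h n : Cplx R := - (eps n)%:C%C * (-1).
have hE n : h n = (eps n)%:C%C by rewrite /h mulrN1 opprK.
have hn0 n : h n != 0 by rewrite hE.
pose u n : Cplx R := (h n)^-1 * (f (h n + 0) - f 0).
have u1 : u @ \oo --> derive1 f 0.
  exact: (derive1_quotient_seq d0 (eps_cvg0 (-1)) hn0).
suff u2 : u @ \oo --> a 1%N by exact: (cvg_unique _ u1 u2).
apply/cvg_cmodP => e e0; have := eps_small (2 * B) e0; apply: filterS => n.
have [en0 en1] := andP (eps01 n).
have en2 : eps n <= 2^-1 by rewrite lef_pV2 ?posrE// ler_nat.
have e1 : cmod (eps n)%:C%C < 1 by rewrite cmod_real gtr0_norm.
have := power_series_remainder2 e1; rewrite cmod_real gtr0_norm// => rem.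
apply: le_trans.
rewrite /u hE addr0 (power_series_at0 fa).
set d := f _ in rem *.
have -> : a 1%N - ((eps n)%:C%C)^-1 * (d - a 0%N) =
    - (((eps n)%:C%C)^-1 * (d - a 0%N - a 1%N * (eps n)%:C%C)).
  by have := eps_neq0 n; set q := (eps n)%:C%C => q0; field.
rewrite normcN normcM normcV cmod_real gtr0_norm// ler_pdivrMl//.
have B0 : 0 <= B := le_trans (cmod_ge0 _) (@aB 1%N isT).
have -> : eps n * (eps n * (2 * B)) = B * (2 * eps n ^+ 2) by ring.
rewrite (le_trans rem)// ler_wpM2l// ler_pdivrMr ?subr_gt0//.
move: (eps n) en0 en2 => x x0 x2; nra.
Qed.

Lemma dilation_quotient_cvg z : cmod z < 1 ->
  (dilation_quotient m z : Cplx R) @[m --> \oo] --> derive1 f z.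
Proof.
move=> z1; rewrite /dilation_quotient; case: eqP => [->|/eqP z0].
  by rewrite derive1_at0; exact: cvg_cst.
apply: (@derive1_quotient_seq f z (fun n => - (eps n)%:C%C * z)).
- exact: fd.
- exact: eps_cvg0.
- by move=> n; rewrite mulf_neq0// oppr_eq0.
Qed.

Let open_disc (r : R) := [set p : R * R | cmod (p.1 +i* p.2)%C < r].

Let measurable_open_disc r : measurable (open_disc r).
Proof.
have mc : measurable_fun setT (fun p : R * R => Num.sqrt (normsq p)).
  apply: (measurableT_comp _ (@measurable_normsq R)).
  by apply: continuous_measurable_fun; exact: sqrt_continuous.
rewrite -[open_disc r]setTI.
exact: (measurable_fun_ltr mc (measurable_cst _ : measurable_fun setT (cst r))).
Qed.

(** The factor 1 / (k + 1) of the moment of order k cancels one of the two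
factors k + 1 of the squared coefficient, which leaves the Koebe series at
r ^ 2. *)
Lemma integral_dilation_poly_le m n (r : R) : 0 <= r < 1 ->
  (\int[mu2]_(p in open_disc r)
     (cmod (\sum_(k < n) dilation_coef m k * cplx p ^+ k) ^+ 2)%:E <=
   (pi * (B ^+ 2 * (r ^+ 2 / (1 - r ^+ 2) ^+ 2)))%:E)%E.
Proof.
move=> /andP[r0 r1].
have sub : open_disc r `<=` disc r.
  move=> p; rewrite /open_disc /disc/= => /ltW pr.
  rewrite -[normsq p]sqr_sqrtr ?addr_ge0 ?sqr_ge0//.
  by rewrite lerXn2r ?nnegrE ?sqrtr_ge0.
apply: (@le_trans _ _ (\int[mu2]_(p in disc r)
    (cmod (\sum_(k < n) dilation_coef m k * cplx p ^+ k) ^+ 2)%:E)%E).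
  apply: (@ge0_subset_integral _ _ _ mu2 _ _ (measurable_open_disc r)
    (@measurable_disc R r)) => //.
  - apply/measurable_EFinP; apply: measurable_funTS.
    exact: measurable_cplx_poly_sq.
  - by move=> p _; rewrite lee_fin sqr_ge0.
rewrite integral_disc_poly_sq// lee_fin.
have dB k : cmod (dilation_coef m k) <= B * k.+1%:R.
  have [e0 e1] := andP (eps01 m).
  have e01 : 0 < eps m <= 1 by rewrite e0 ltW.
  have /andP[b0 b1] := one_sub_pow_bound k.+1 e01.
  rewrite normcM cmod_real ger0_norm//.
  by rewrite ler_pM// ?cmod_ge0// aB.
apply: (@le_trans _ _
    (pi * (B ^+ 2 * \sum_(k < n) k.+1%:R * (r ^+ 2) ^+ k.+1))).
  rewrite !mulr_sumr; apply: ler_sum => k _.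
  have -> : pi * (B ^+ 2 * (k.+1%:R * (r ^+ 2) ^+ k.+1)) =
      (B * k.+1%:R) ^+ 2 * (pi * r ^+ (2 * k.+1) / k.+1%:R).
    have : k.+1%:R != 0 :> R by rewrite pnatr_eq0.
    by rewrite exprM; move: (k.+1%:R : R) => K K0; field.
  rewrite ler_wpM2r//.
    by rewrite divr_ge0// mulr_ge0 ?exprn_ge0// pi_ge0.
  by rewrite lerXn2r ?nnegrE ?cmod_ge0// (le_trans (cmod_ge0 _) (dB k)).
rewrite ler_wpM2l ?pi_ge0// ler_wpM2l ?sqr_ge0// sum_natmul_geom_le//.
by rewrite sqr_ge0/= expr_lt1.
Qed.

(** Fatou's lemma is used twice: first for the partial sums of
the difference quotients, then for the quotients themselves. *)
Lemma area_le (r : R) : 0 <= r < 1 ->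
  (area f r <= (pi * (B ^+ 2 * (r ^+ 2 / (1 - r ^+ 2) ^+ 2)))%:E)%E.
Proof.
move=> r01; have [r0 r1] := andP r01.
have in1 p : open_disc r p -> cmod (cplx p) < 1 by move=> /lt_trans; apply.
have inner m x : open_disc r x ->
    cmod (\sum_(k < n) dilation_coef m k * cplx x ^+ k) ^+ 2 @[n --> \oo] -->
    cmod (dilation_quotient m (cplx x)) ^+ 2.
  by move=> /in1 xr; exact: (cvg_cmod_sqr (dilation_quotient_series xr)).
have mpoly m n : measurable_fun (open_disc r)
    (fun p => cmod (\sum_(k < n) dilation_coef m k * cplx p ^+ k) ^+ 2).
  by apply: measurable_funTS; exact: measurable_cplx_poly_sq.
rewrite /area.
apply: (@fatou_bound _ _ mu2 (open_disc r)
  (fun m p => cmod (dilation_quotient m (cplx p)) ^+ 2)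
  (fun p => cmod (derive1 f (p.1 +i* p.2)%C) ^+ 2)).
- exact: measurable_open_disc.
- move=> m; apply: (measurable_fun_cvg _ (inner m)); exact: mpoly.
- by move=> m p _; exact: sqr_ge0.
- by move=> p /in1 pr; exact: (cvg_cmod_sqr (dilation_quotient_cvg pr)).
move=> m; apply: (@fatou_bound _ _ mu2 (open_disc r)
  (fun n p => cmod (\sum_(k < n) dilation_coef m k * cplx p ^+ k) ^+ 2)).
- exact: measurable_open_disc.
- exact: mpoly.
- by move=> n p _; exact: sqr_ge0.
- exact: inner.
- by move=> n; exact: integral_dilation_poly_le.
Qed.

End bounded_coefficients.
End area_bound.

(** * The radius and the final inequality *)

Definition R5_poly (R : realType) (alpha beta r : R) :=
  alpha * r ^+ 3 + alpha * r ^+ 2 + (4 * beta - alpha) * r - alpha.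

Section radius.
Variables (R : realType) (alpha beta : R).

Local Notation phi := (R5_poly alpha beta).

Lemma R5_polyE r : phi r = 4 * beta * r - alpha * ((1 - r) * (1 + r) ^+ 2).
Proof. by rewrite /R5_poly; ring. Qed.

(** The difference of the values at r and s is (r - s) times a quantity that is
at least 4 beta - alpha > 0. *)
Lemma R5_poly_lt (s r : R) : 0 < alpha -> 8 * alpha / 9 <= beta ->
  0 <= s -> s < r -> phi s < phi r.
Proof.
move=> alpha0 ab s0 sr; rewrite -subr_gt0.
have -> : phi r - phi s =
  (r - s) * (4 * beta - alpha + alpha * (r + s + (r ^+ 2 + r * s + s ^+ 2))).
  by rewrite /R5_poly; ring.
have r0 : 0 <= r by rewrite (le_trans s0)// ltW.
have b4 : 0 < 4 * beta - alpha by lra.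
rewrite mulr_gt0 ?subr_gt0// ltr_pwDl//.
by rewrite mulr_ge0 ?(ltW alpha0)// !addr_ge0 ?mulr_ge0 ?sqr_ge0.
Qed.

Lemma R5_root_exists_unique : 0 < alpha -> 8 * alpha / 9 <= beta ->
  exists! r : R, R5_root alpha beta r.
Proof.
move=> alpha0 ab.
pose p : {poly R} :=
  alpha *: 'X^3 + alpha *: 'X^2 + (4 * beta - alpha) *: 'X - alpha%:P.
have pE r : p.[r] = phi r 
  by rewrite !(hornerD, hornerN, hornerZ, hornerXn, hornerX, hornerC).
have [||r /andP[r0 r3] /rootP] := @poly_ivt R p 0 3^-1.
- by rewrite invr_ge0.
- by rewrite !pE !R5_polyE; apply/andP; split; [lra|nra].
rewrite pE => pr.
have {}r0 : 0 < r.
  rewrite lt0r r0 andbT; apply/eqP => r00.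
  by move: pr; rewrite r00 R5_polyE; nra.
exists r; split; first by split => //; apply/andP.
move=> s [/andP[s0 _] ps0]; have {ps0} ps : phi s = 0 := ps0.
apply/eqP; rewrite eq_le !leNgt.
apply/andP; split; apply/negP.
  by move=> /(R5_poly_lt alpha0 ab (ltW s0)); rewrite pr ps ltxx.
by move=> /(R5_poly_lt alpha0 ab (ltW r0)); rewrite pr ps ltxx.
Qed.

(** The second bound says that the defining polynomial is nonpositive at r.
When beta is below 8 alpha / 9 it follows from the case beta = 8 alpha / 9, for
which the root is 1 / 3. *)
Lemma le_R5 (r : R) : 0 < alpha -> 0 <= r -> r <= R5 alpha beta ->
  r <= 3^-1 /\ 4 * beta * r <= alpha * ((1 - r) * (1 + r) ^+ 2).
Proof.
move=> alpha0 r0; rewrite /R5; case: ltP => [ba r3|ab].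
  split => //; apply: (@le_trans _ _ (4 * (8 * alpha / 9) * r)).
    by rewrite ler_wpM2r// ler_wpM2l// ltW.
  rewrite -subr_ge0.
  (* The root 1 / 3 of the case beta = 8 alpha / 9 is factored out. *)
  have -> : alpha * ((1 - r) * (1 + r) ^+ 2) - 4 * (8 * alpha / 9) * r =
      alpha * ((1 - 3 * r) * (1 + 4 / 9 * r + r ^+ 2 / 3)) by field.
  rewrite mulr_ge0 ?(ltW alpha0)// mulr_ge0//; first lra.
  by rewrite !addr_ge0// ?divr_ge0 ?mulr_ge0 ?sqr_ge0.
case: xgetP => [s _ [/andP[s0 s3] ps] rs|noroot _]; last first.
  by have [s [/noroot]] := R5_root_exists_unique alpha0 ab.
split; first exact: le_trans s3.
rewrite -subr_le0 -R5_polyE; move: rs; rewrite le_eqVlt => /predU1P[->|rs].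
  by rewrite /R5_poly ps.
by rewrite ltW// (lt_le_trans (R5_poly_lt alpha0 ab r0 rs))// /R5_poly ps.
Qed.

(** The hypothesis on r turns the area term into a multiple of alpha: with
u = r / (1 - r) <= 1 / 2, it is at most alpha (1 - x ^ 2) ^ 2 u / 4. It remains
to see that x + u ((1 - x ^ 2) + (1 - x ^ 2) ^ 2 / 4) is at most 1; this is
worst at u = 1 / 2, where the difference is (1 - x) ^ 3 (3 + x) / 8. *)
Lemma bohr_area_inequality (x r : R) :
  0 < alpha -> alpha <= 1 -> 0 <= x <= 1 -> 0 <= r <= 3^-1 ->
  4 * beta * r <= alpha * ((1 - r) * (1 + r) ^+ 2) ->
  alpha * (x + (1 - x ^+ 2) * (r / (1 - r))) +
    beta * ((1 - x ^+ 2) ^+ 2 * (r ^+ 2 / (1 - r ^+ 2) ^+ 2)) <= 1.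
Proof.
move=> alpha0 alpha1 /andP[x0 x1] /andP[r0 r3] br.
have r1 : 0 < 1 - r by lra.
pose u := r / (1 - r).
have u0 : 0 <= u by rewrite divr_ge0// ltW.
have u2 : u <= 2^-1 by rewrite ler_pdivrMr//; lra.
have bu : beta * (r ^+ 2 / (1 - r ^+ 2) ^+ 2) <= alpha * (u / 4).
  have -> : r ^+ 2 / (1 - r ^+ 2) ^+ 2 =
      4 * r / ((1 - r) * (1 + r) ^+ 2) * (u / 4).
    rewrite /u; field; apply/and3P; split => //; apply/eqP; nra.
  rewrite mulrA ler_wpM2r//; first by rewrite divr_ge0.
  have D0 : 0 < (1 - r) * (1 + r) ^+ 2 by rewrite mulr_gt0// exprn_gt0//; lra.
  by rewrite mulrA ler_pdivrMr// [leLHS](_ : _ = 4 * beta * r)//; ring.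
rewrite -/u [beta * _]mulrCA.
have B0 : 0 <= 1 - x ^+ 2 by rewrite subr_ge0 expr_le1.
apply: (@le_trans _ _ (alpha * (x + (1 - x ^+ 2) * u) +
   (1 - x ^+ 2) ^+ 2 * (alpha * (u / 4)))).
  by rewrite lerD2l ler_wpM2l ?sqr_ge0.
have -> : alpha * (x + (1 - x ^+ 2) * u) +
    (1 - x ^+ 2) ^+ 2 * (alpha * (u / 4)) =
   alpha * (x + u * (1 - x ^+ 2 + (1 - x ^+ 2) ^+ 2 / 4)) by field.
apply: (le_trans _ alpha1); rewrite ger_pMr//.
apply: (@le_trans _ _ (x + 2^-1 * (1 - x ^+ 2 + (1 - x ^+ 2) ^+ 2 / 4))).
  by rewrite lerD2l ler_wpM2r// addr_ge0// divr_ge0// sqr_ge0.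
rewrite -subr_ge0.
have -> : 1 - (x + 2^-1 * (1 - x ^+ 2 + (1 - x ^+ 2) ^+ 2 / 4)) =
  (1 - x) ^+ 2 * (1 - x) * (3 + x) / 8 by field.
by rewrite divr_ge0// !mulr_ge0 ?sqr_ge0//; lra.
Qed.

End radius.

Lemma majorant_le (R : realType) (a : nat -> Cplx R) (B r : R) : 0 <= r < 1 ->
  (forall k, (0 < k)%N -> cmod (a k) <= B) ->
  (majorant a r <= (cmod (a 0%N) + B * (r / (1 - r)))%:E)%E.
Proof.
move=> /andP[r0 r1] aB.
have B0 : 0 <= B := le_trans (cmod_ge0 _) (aB 1%N isT).
apply: lime_le.
  apply: is_cvg_nneseries => k _ _.
  by rewrite lee_fin mulr_ge0 ?cmod_ge0 ?exprn_ge0.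
exists 1%N => // -[//|n] _ /=.
rewrite sumEFin lee_fin big_nat_recl// expr0 mulr1 lerD2l.
apply: (@le_trans _ _ (B * \sum_(1 <= k < n.+1) r ^+ k)).
  rewrite big_add1/= mulr_sumr; apply: ler_sum => k _.
  by rewrite ler_wpM2r ?exprn_ge0// aB.
rewrite ler_wpM2l// -[X in X / _]expr1; apply: geometric_tail_le.
by rewrite r0.
Qed.

Theorem theorem3p5 (R : realType) (alpha beta : R)
    (halpha0 : 0 < alpha) (halpha1 : alpha <= 1) (hbeta : 0 < beta) :
  (8 * alpha / 9 <= beta -> exists! r : R, R5_root alpha beta r) /\
  (forall (f : Cplx R -> Cplx R) (a : nat -> Cplx R),
     BA f -> power_series_on_disk f a ->
     forall (z : Cplx R) (r : R), cmod z < 1 -> cmod z = r ->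
       r <= R5 alpha beta ->
       (alpha%:E * majorant a r + beta%:E * (area f r * (pi^-1)%:E) <= 1)%E).
Proof.
split; first exact: R5_root_exists_unique.
move=> f a fBA fa z r z1 zr rR5.
have r0 : 0 <= r by rewrite -zr cmod_ge0.
have [r3 br] := le_R5 halpha0 r0 rR5.
have r01 : 0 <= r < 1 by rewrite r0 -zr.
set x := cmod (a 0%N).
have x01 : 0 <= x <= 1 by rewrite cmod_ge0 ltW// (coef0_lt1 fa fBA).
have aB k (k0 : (0 < k)%N) : cmod (a k) <= 1 - x ^+ 2 := coef_bound fa fBA k0.
have fd w : cmod w < 1 -> derivable f w 1 by move=> /fBA[].
have pi0 : 0 < pi :> R by exact: pi_gt0.
have Sr : (area f r * (pi^-1)%:E <=
    ((1 - x ^+ 2) ^+ 2 * (r ^+ 2 / (1 - r ^+ 2) ^+ 2))%:E)%E.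
  rewrite lee_pdivrMr//; rewrite -EFinM mulrC.
  exact: (area_le fa fd aB r01).
have r03 : 0 <= r <= 3^-1 by rewrite r0.
have := bohr_area_inequality halpha0 halpha1 x01 r03 br.
rewrite -lee_fin; apply: le_trans.
rewrite EFinD (EFinM alpha) (EFinM beta).
apply: leeD; apply: lee_wpmul2l.
- by rewrite lee_fin ltW.
- exact: (majorant_le r01 aB).
- by rewrite lee_fin ltW.
- exact: Sr.
Qed.
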